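(* Let $\Phi=(\{E_i\}_{i=0}^d;\{E^*_i\}_{i=0}^d)$ be a symmetric idempotent system on $V$, with associated elements $A_i\in\mathcal{M}$. Then the elements $\{A_i\}_{i=0}^d$ form a basis of the vector space $\mathcal{M}$.
   Context: $\mathbb{F}$ is a field, $d\ge 0$ an integer, $V$ a vector space over $\mathbb{F}$ of dimension $d+1$, $\mathrm{End}(V)$ the $\mathbb{F}$-algebra of linear maps $V\to V$; $\mathrm{tr}$ means trace. An antiautomorphism of an algebra $\mathcal{A}$ is an $\mathbb{F}$-linear bijection $\tau:\mathcal{A}\to\mathcal{A}$ with $(YZ)^\tau=Z^\tau Y^\tau$. Idempotent system on $V$: a sequence $\Phi=(\{E_i\}_{i=0}^d;\{E^*_i\}_{i=0}^d)$ of elements of $\mathrm{End}(V)$ such that $E_iE_j=\delta_{i,j}E_i$, $\mathrm{rank}(E_i)=1$, $E^*_iE^*_j=\delta_{i,j}E^*_i$, $\mathrm{rank}(E^*_i)=1$, $E_0E^*_iE_0\neq 0$, $E^*_0E_iE^*_0\ne 0$ for $0\le i,j\le d$. It is symmetric if there is an antiautomorphism $\dagger$ of $\mathrm{End}(V)$ fixing each $E_i$ and each $E^*_i$. $\mathcal{M}$ (resp. $\mathcal{M}^*$) is the subalgebra of $\mathrm{End}(V)$ generated by $\{E_i\}_{i=0}^d$ (resp. $\{E^*_i\}_{i=0}^d$). $\nu=\mathrm{tr}(E_0E^*_0)^{-1}$ (this trace is nonzero). $\rho^*:\mathcal{M}^*\to\mathcal{M}$ is the unique $\mathbb{F}$-linear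 map with $ZE_0E^*_0=Z^{\rho^*}E^*_0$ for all $Z\in\mathcal{M}^*$. For $0\le i\le d$, $A_i=\nu(E^*_i)^{\rho^*}\in\mathcal{M}$. *)

(* Defs.v *)
From HB Require Import structures.
From mathcomp Require Import all_boot all_order all_algebra all_field.

Set Implicit Arguments.
Unset Strict Implicit.
Unset Printing Implicit Defensive.

Import GRing.Theory.
Local Open Scope ring_scope.

Definition endo (F : fieldType) (d : nat) (V : vectType F)
  (dimV : \dim {:V} = d.+1) : predArgType := 'End(V).

Section EndAlgebra.

Variables (F : fieldType) (d : nat) (V : vectType F).
Hypothesis dimV : \dim {:V} = d.+1.

Local Notation A := (endo dimV).

Definition lfun_of (f : A) : 'End(V) := f.

HB.instance Definition _ := Vector.copy A 'End(V).

Fact endo_proper : (0 < dim V)%N.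
Proof. by rewrite -dimvf dimV. Qed.

(* MathComp's own algebra structure on 'End(V), lfun_algType, has the reversed
   product f * g = g \o f. Here f * g = f \o g. *)
HB.instance Definition _ := GRing.Zmodule_isNzRing.Build A
  (@comp_lfunA F V V V V) (@comp_lfun1l F V V) (@comp_lfun1r F V V)
  (@comp_lfunDl F V V V) (@comp_lfunDr F V V V) (lfun1_neq0 endo_proper).

HB.instance Definition _ := GRing.Lmodule_isLalgebra.Build F A
  (@comp_lfunZl F V V V).

HB.instance Definition _ := GRing.Lalgebra_isAlgebra.Build F A
  (@comp_lfunZr F V V V).

HB.instance Definition _ := Algebra_isFalgebra.Build F A.

Lemma endo_inj : injective lfun_of. Proof. by []. Qed.

Lemma endo_mulE (f g : A) : lfun_of (f * g) = (lfun_of f \o lfun_of g)%VF.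
Proof. by []. Qed.

Lemma endo_oneE : lfun_of 1 = \1%VF.
Proof. by []. Qed.

Lemma endo_sumE I (r : seq I) (P : pred I) (f : I -> A) :
  lfun_of (\sum_(i <- r | P i) f i) = \sum_(i <- r | P i) lfun_of (f i).
Proof. exact: (big_morph lfun_of). Qed.

Lemma endo_scaleE (a : F) (f : A) : lfun_of (a *: f) = a *: lfun_of f.
Proof. by []. Qed.

Definition endo_rank (f : A) : nat := \dim (limg (lfun_of f)).

(* mxof is the matrix acting on row vectors, i.e. the transpose of the usual
   one; neither this nor the choice of basis affects the trace. *)
Definition endo_trace (f : A) : F :=
  \tr (passmx.mxof (vbasis {:V}) (vbasis {:V}) (lfun_of f)).

End EndAlgebra.

Section IdempotentSystem.

Variables (F : fieldType) (d : nat) (V : vectType F).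
Variable dimV : \dim {:V} = d.+1.

Local Notation A := (endo dimV).
Implicit Types E Es : 'I_d.+1 -> A.

Record idempotent_system E Es : Prop := IdempotentSystem {
  idsys_orth : forall i j, E i * E j = (i == j)%:R *: E i;
  idsys_rank : forall i, endo_rank (E i) = 1%N;
  idsys_orth_star : forall i j, Es i * Es j = (i == j)%:R *: Es i;
  idsys_rank_star : forall i, endo_rank (Es i) = 1%N;
  idsys_neq0 : forall i, E ord0 * Es i * E ord0 != 0;
  idsys_neq0_star : forall i, Es ord0 * E i * Es ord0 != 0
}.

Definition antiautomorphism (dag : 'End(A)) : Prop :=
  bijective dag /\ forall Y Z, dag (Y * Z) = dag Z * dag Y.

Definition symmetric_idempotent_system E Es : Prop :=
  idempotent_system E Es /\
  exists2 dag : 'End(A), antiautomorphism dag &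
    forall i, dag (E i) = E i /\ dag (Es i) = Es i.

(* The inner brackets are the linear span, the outer ones the smallest
   subalgebra (containing 1). *)
Definition gen_subalg E : {aspace A} := <<<<codom E>>>>%AS.

Lemma mem_gen_subalg E i : E i \in gen_subalg E.
Proof. exact/(subvP (sub_agenv _))/memv_span/codom_f. Qed.

Definition gen_elt E i : subvs_of (gen_subalg E) := Subvs (mem_gen_subalg E i).

Definition nu E Es : F := (endo_trace (E ord0 * Es ord0))^-1.

Definition is_rho_star E Es
    (rho : 'Hom(subvs_of (gen_subalg Es), subvs_of (gen_subalg E))) : Prop :=
  forall Z, vsval Z * E ord0 * Es ord0 = vsval (rho Z) * Es ord0.

Lemma rank1P (f : A) : endo_rank f = 1%N ->
  exists2 v : V, v != 0 & limg (lfun_of f) = <[v]>%VS.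
Proof.
move=> r1; have /eqP := r1; rewrite /endo_rank => dim1.
set v := vpick (limg (lfun_of f)); exists v.
  by rewrite vpick0 -dimv_eq0 (eqP dim1).
apply/esym/eqP; rewrite eqEdim -memvE memv_pick (eqP dim1) dim_vline.
by rewrite vpick0 -dimv_eq0 (eqP dim1).
Qed.

Lemma idsys_sum1 E Es : idempotent_system E Es -> \sum_i E i = 1.
Proof.
case=> orth rk _ _ _ _.
have orthE i j u : lfun_of (E i) (lfun_of (E j) u) =
    (i == j)%:R *: lfun_of (E i) u.
  by rewrite -comp_lfunE -endo_mulE orth endo_scaleE scale_lfunE.
pose b := [tuple vpick (limg (lfun_of (E i))) | i < d.+1].
have bE i : b`_(i : 'I_d.+1) = vpick (limg (lfun_of (E i))).
  by rewrite -tnth_nth tnth_mktuple.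
have b_n0 i : b`_(i : 'I_d.+1) != 0.
  by rewrite bE vpick0 -dimv_eq0 [\dim _]rk.
have Eb i j : lfun_of (E i) b`_(j : 'I_d.+1) = (i == j)%:R *: b`_j.
  rewrite bE; have /memv_imgP[u _ ->] := memv_pick (limg (lfun_of (E j))).
  by rewrite orthE; case: eqP => [->|]; rewrite ?scale0r.
have fb : free b.
  apply/freeP => k k0 i.
  have := congr1 (lfun_of (E i)) k0; rewrite linear0 linear_sum (bigD1 i) //=.
  rewrite big1 => [|j ji]; rewrite linearZ /= Eb.
    by rewrite eqxx scale1r addr0 => /eqP; rewrite scaler_eq0 (negPf (b_n0 i)) orbF => /eqP.
  by rewrite eq_sym (negPf ji) scale0r scaler0.
have bb : basis_of {:V} b.
  by rewrite basisEfree fb subvf dimV size_tuple leqnn.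
apply/endo_inj/lfunP => u; rewrite endo_oneE id_lfunE.
rewrite (coord_basis bb (memvf u)) linear_sum /=; apply: eq_bigr => j _.
rewrite linearZ; congr (_ *: _); rewrite /= endo_sumE sum_lfunE (bigD1 j) //= big1.
  by rewrite Eb eqxx scale1r addr0.
by move=> i ij; rewrite Eb (negPf ij) scale0r.
Qed.

Lemma mem_gen_subalgP E Es Y : idempotent_system E Es ->
  reflect (exists c : 'I_d.+1 -> F, Y = \sum_i c i *: E i) (Y \in gen_subalg E).
Proof.
move=> idE; have sumE := idsys_sum1 idE; have orth := idsys_orth idE.
have spanP Z : reflect (exists c : 'I_d.+1 -> F, Z = \sum_i c i *: E i)
    (Z \in <<codom E>>%VS).
  apply: (iffP idP) => [/coord_span|[c ->]].
    move=> ->; exists (fun i => coord (codom_tuple E) (cast_ord (esym (card_ord _)) i) Z).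
    rewrite (reindex (cast_ord (card_ord d.+1))) /=; last first.
      by exists (cast_ord (esym (card_ord d.+1))) => i _; rewrite ?cast_ordK ?cast_ordKV.
    apply: eq_bigr => i _; rewrite cast_ordK; congr (_ *: _).
    rewrite /codom /image_mem (nth_map ord0) ?size_enum_ord ?ltn_ord //; last first.
      by rewrite -[X in (_ < X)%N](card_ord d.+1) ltn_ord.
    by congr E; apply/val_inj; rewrite /= nth_enum_ord // -[X in (_ < X)%N](card_ord d.+1) ltn_ord.
  by apply: memv_suml => i _; apply/memvZ/memv_span/codom_f.
suff -> : (gen_subalg E : {vspace A}) = <<codom E>>%VS by exact: spanP.
apply/eqP; rewrite eqEsubv sub_agenv andbT.
apply: agenv_sub_modl.
  by rewrite -memvE -sumE; apply: memv_suml => i _; apply/memv_span/codom_f.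
apply/prodvP => _ _ /spanP[c ->] /spanP[c' ->]; apply/spanP.
exists (fun i => c i * c' i).
rewrite mulr_suml; apply: eq_bigr => i _.
rewrite mulr_sumr (bigD1 i) //= big1 => [|j ji].
  by rewrite -scalerAl -scalerAr orth eqxx scale1r scalerA addr0.
by rewrite -scalerAl -scalerAr orth eq_sym (negPf ji) scale0r !scaler0.
Qed.

(* For an idempotent system, is_rho_star has exactly one solution, so it
   characterizes the map rho^*. *)
Lemma rho_star_exists_unique E Es : idempotent_system E Es ->
  exists! rho : 'Hom(subvs_of (gen_subalg Es), subvs_of (gen_subalg E)),
    is_rho_star rho.
Proof.
move=> idE; have sumE := idsys_sum1 idE; have orth := idsys_orth idE.
have EEs_n0 i : E i * Es ord0 != 0.
  apply: contraNneq (idsys_neq0_star idE i) => E0.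
  by rewrite -mulrA E0 mulr0.
have inj (Y : A) : Y \in gen_subalg E -> Y * Es ord0 = 0 -> Y = 0.
  case/(mem_gen_subalgP _ idE) => c -> Y0; apply: big1 => i _.
  have := congr1 ( *%R (E i)) Y0; rewrite mulr0 mulr_suml mulr_sumr (bigD1 i) //=.
  rewrite big1 => [|j ji].
    rewrite addr0 -scalerAl -scalerAr mulrA orth eqxx scale1r => /eqP.
    by rewrite scaler_eq0 (negPf (EEs_n0 i)) orbF => /eqP->; rewrite scale0r.
  by rewrite -scalerAl -scalerAr mulrA orth eq_sym (negPf ji) scale0r mul0r scaler0.
have surj (X : A) : exists2 Y, Y \in gen_subalg E & X * Es ord0 = Y * Es ord0.
  have [w w0 Ew] := rank1P (idsys_rank_star idE ord0).
  have Esw u : exists a, lfun_of (Es ord0) u = a *: w.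
    by apply/vlineP; rewrite -Ew memv_img ?memvf.
  have Eiw i : lfun_of (E i) w != 0.
    apply: contraNneq (EEs_n0 i) => Eiw0; apply/eqP; apply: endo_inj; apply/lfunP => u.
    rewrite endo_mulE comp_lfunE; have [a ->] := Esw u.
    by rewrite linearZ /= Eiw0 scaler0 zero_lfunE.
  have /fin_all_exists[c cP] i :
      exists a, lfun_of (E i) (lfun_of X w) = a *: lfun_of (E i) w.
    have [v v0 Ev] := rank1P (idsys_rank idE i).
    have lim u : exists a, lfun_of (E i) u = a *: v.
      by apply/vlineP; rewrite -Ev memv_img ?memvf.
    have [a aE] := lim w; have [b bE] := lim (lfun_of X w).
    have a0 : a != 0.
      by apply: contraNneq (Eiw i) => a0; rewrite aE a0 scale0r.
    by exists (b / a); rewrite aE bE scalerA divfK.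
  exists (\sum_i c i *: E i); first by apply/(mem_gen_subalgP _ idE); exists c.
  apply/endo_inj/lfunP => u; rewrite !endo_mulE !comp_lfunE.
  have [a ->] := Esw u; rewrite !linearZ /=; congr (_ *: _).
  rewrite -[LHS](@id_lfunE _ V) -(endo_oneE dimV) -sumE !endo_sumE !sum_lfunE.
  by apply: eq_bigr => i _; rewrite cP endo_scaleE scale_lfunE.
pose h : 'Hom(subvs_of (gen_subalg E), A) :=
  (amulr (Es ord0) \o linfun (@vsval _ _ (gen_subalg E)))%VF.
have hE Y : h Y = vsval Y * Es ord0.
  by rewrite comp_lfunE !lfunE.
pose rho : 'Hom(subvs_of (gen_subalg Es), subvs_of (gen_subalg E)) :=
  (h^-1 \o (amulr (E ord0 * Es ord0) \o linfun (@vsval _ _ (gen_subalg Es))))%VF.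
have rhoP : is_rho_star rho.
  move=> Z; rewrite -hE.
  have -> : rho Z = (h^-1)%VF (vsval Z * E ord0 * Es ord0).
    by rewrite !comp_lfunE !lfunE /= mulrA.
  rewrite limg_lfunVK //.
  have [Y YM ->] := surj (vsval Z * E ord0).
  by apply/memv_imgP; exists (Subvs YM); rewrite ?memvf ?hE.
exists rho; split=> // rho' rho'P; apply/lfunP => Z; apply/val_inj/eqP.
rewrite -subr_eq0; apply/eqP/inj; first by rewrite rpredB ?subvsP.
by apply/eqP; rewrite mulrBl subr_eq0 -(rhoP Z) -(rho'P Z).
Qed.

Definition assoc_elt E Es
    (rho : 'Hom(subvs_of (gen_subalg Es), subvs_of (gen_subalg E)))
    (i : 'I_d.+1) : subvs_of (gen_subalg E) :=
  nu E Es *: rho (gen_elt Es i).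

End IdempotentSystem.

(* Main.v *)
Require Import Defs.
From mathcomp Require Import all_boot all_order all_algebra all_field.

(** Write [tr] for the trace. If [f] has rank one, then [f X f] is a scalar
    multiple of [f], and the scalar is [tr (f X)]: both [f] and [f X] map into
    the line of [f], on which [f X] acts by its trace. For [f = E_0] and
    [X = E*_0] this reads [E_0 E*_0 E_0 = tr (E_0 E*_0) E_0]. The left side is
    nonzero, so the trace is nonzero, and this has two consequences. First,
    [nu] is a genuine inverse, hence nonzero. Secondly,
    [E*_i E_0 E*_0 E_0 = tr (E_0 E*_0) E*_i E_0] is nonzero, because
    [E_0 E*_i E_0] is, so [E*_i E_0 E*_0] is nonzero for every [i].

    A relation [\sum_i k_i A_i = 0] says that [rho^*] kills
    [Z = \sum_i k_i E*_i], hence that [Z E_0 E*_0 = 0]. Multiplying on the left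
    by [E*_j] isolates [k_j E*_j E_0 E*_0 = 0], so [k_j = 0]. The [d + 1]
    elements [A_i] are therefore independent, and they form a basis because the
    algebra generated by the [E_i] is already spanned by the [d + 1]
    elements [E_i]. *)

Set Implicit Arguments.
Unset Strict Implicit.
Unset Printing Implicit Defensive.

Import GRing.Theory.
Local Open Scope ring_scope.

(** A map into the line of [v] has the form [u |-> phi u *: v] for a linear form
    [phi] (when [v] is nonzero), and both its trace and its eigenvalue on [v]
    are [phi v], expanded in coordinates. *)
Lemma endo_trace_line (F : fieldType) (d : nat) (V : vectType F)
    (dimV : \dim {:V} = d.+1) (g : endo dimV) (v : V) :
  (limg (lfun_of g) <= <[v]>)%VS -> lfun_of g v = endo_trace g *: v.
Proof.
move=> sgv; pose e := vbasis {:V}.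
have eb : basis_of {:V} e by exact: vbasisP.
have /fin_all_exists[c cE] (i : 'I_(\dim {:V})) :
    exists a, lfun_of g e`_i = a *: v.
  by apply/vlineP/(subvP sgv)/memv_img/memvf.
have -> : endo_trace g = \sum_i coord e i v * c i.
  apply: eq_bigr => i _; rewrite !mxE /= passmx.vecof_delta cE linearZ.
  by rewrite /= mulrC.
rewrite [in LHS](coord_basis eb (memvf v)) linear_sum scaler_suml /=.
by apply: eq_bigr => i _; rewrite linearZ /= cE scalerA.
Qed.

Section IdempotentSystem.

Variables (F : fieldType) (d : nat) (V : vectType F).
Variable dimV : \dim {:V} = d.+1.

Implicit Types f X : endo dimV.
Implicit Types E Es : 'I_d.+1 -> endo dimV.

(** With [v] spanning the image of [f], each [f u] is a multiple of [v], and
    [f * X] scales [v] by its trace. *)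
Lemma rank1_sandwich f X :
  endo_rank f = 1%N -> f * X * f = endo_trace (f * X) *: f.
Proof.
case/rank1P=> v _ fv; apply/endo_inj/lfunP => u.
rewrite endo_scaleE scale_lfunE endo_mulE comp_lfunE.
have /vlineP[b ->] : lfun_of f u \in <[v]>%VS by rewrite -fv memv_img ?memvf.
rewrite linearZ /= endo_trace_line; first by rewrite !scalerA mulrC.
by rewrite -fv endo_mulE limg_comp limgS ?subvf.
Qed.

Lemma idsys_trace_neq0 E Es :
  idempotent_system E Es -> endo_trace (E ord0 * Es ord0) != 0.
Proof.
move=> idE; apply: contraNneq (idsys_neq0 idE ord0) => tr0.
by rewrite rank1_sandwich ?tr0 ?scale0r //; exact: idsys_rank idE ord0.
Qed.

(** It suffices to multiply on the right by [E ord0]: this leaves a nonzero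
    multiple of [Es i * E ord0]. *)
Lemma idsys_triple_neq0 E Es i :
  idempotent_system E Es -> Es i * E ord0 * Es ord0 != 0.
Proof.
move=> idE; apply: contraNneq (idsys_neq0 idE i) => Z0.
have : Es i * (E ord0 * Es ord0 * E ord0) = 0 by rewrite !mulrA Z0 mul0r.
rewrite rank1_sandwich ?(idsys_rank idE) // -scalerAr => /eqP.
rewrite scaler_eq0 (negPf (idsys_trace_neq0 idE)) /= => /eqP EsE0.
by rewrite -mulrA EsE0 mulr0.
Qed.

Lemma dim_gen_subalg_le E Es :
  idempotent_system E Es -> (\dim (gen_subalg E) <= d.+1)%N.
Proof.
move=> idE; have -> : d.+1 = size (codom E) by rewrite size_codom card_ord.
apply: leq_trans (dim_span _); apply/dimvS/subvP => Y.
case/(mem_gen_subalgP _ idE) => c ->.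
by apply: memv_suml => i _; apply/memvZ/memv_span/codom_f.
Qed.

(** The orthogonality of the [Es i] isolates one coefficient of a vanishing
    combination, as a scalar factor of the nonzero element
    [Es j * E ord0 * Es ord0]. *)
Lemma free_assoc_elt E Es
    (rho : 'Hom(subvs_of (gen_subalg Es), subvs_of (gen_subalg E))) :
  idempotent_system E Es -> is_rho_star rho ->
  free [tuple assoc_elt rho i | i < d.+1].
Proof.
move=> idE rhoP; apply/freeP => k k0 j.
pose Z := \sum_i k i *: gen_elt Es i.
have rhoZ0 : rho Z = 0.
  have /eqP : nu E Es *: rho Z = 0.
    rewrite -[RHS]k0 linear_sum scaler_sumr; apply: eq_bigr => i _.
    by rewrite linearZ -tnth_nth tnth_mktuple /= !scalerA mulrC.
  by rewrite scaler_eq0 invr_eq0 (negPf (idsys_trace_neq0 idE)) => /eqP.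
have /(congr1 ( *%R (Es j))) := rhoP Z.
rewrite rhoZ0 linear0 mul0r mulr0 linear_sum !mulrA mulr_sumr (bigD1 j) //=.
rewrite big1 => [|i ij].
  rewrite -scalerAr (idsys_orth_star idE) eqxx scale1r addr0 -!scalerAl => /eqP.
  by rewrite scaler_eq0 (negPf (idsys_triple_neq0 j idE)) orbF => /eqP.
by rewrite -scalerAr (idsys_orth_star idE) eq_sym (negPf ij) scale0r scaler0.
Qed.

End IdempotentSystem.

Theorem lemma7p7 (F : fieldType) (d : nat) (V : vectType F)
    (dimV : \dim {:V}%VS = d.+1) (E Es : 'I_d.+1 -> endo dimV)
    (symPhi : symmetric_idempotent_system E Es)
    (rho : 'Hom(subvs_of (gen_subalg Es), subvs_of (gen_subalg E)))
    (rhoP : is_rho_star rho) :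
  basis_of {:subvs_of (gen_subalg E)}%VS
    [tuple assoc_elt rho i | i < d.+1].
Proof.
have [idE _] := symPhi.
rewrite basisEfree free_assoc_elt // subvf size_tuple dimvf.
exact: dim_gen_subalg_le idE.
Qed.
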